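(* Let $(M,g)$ be a Riemannian manifold of dimension $n$ with Riemann curvature tensor $R$. For $4\leq 2k+2\leq n$, $$h_{2k+2}=\Bigl\langle \frac{c^{2k-2}R^k}{(2k-2)!},R\Bigr\rangle-\Bigl\langle \frac{c^{2k-1}R^k}{(2k-1)!},cR\Bigr\rangle+h_{2k}\,h_2 .$$ In particular, for $k=1$, $$h_4=|R|^2-|cR|^2+\tfrac14|c^2R|^2 .$$
   Context: A $(p,q)$ double form on $(M,g)$ is a section of $\Lambda^pT^*M\otimes\Lambda^qT^*M$. Powers denote the exterior (Kulkarni–Nomizu) product $(\omega_1\otimes\omega_2)(\theta_1\otimes\theta_2)=(\omega_1\wedge\theta_1)\otimes(\omega_2\wedge\theta_2)$. The contraction is $c\,\omega(x_2,\dots;y_2,\dots)=\sum_i\omega(e_i,x_2,\dots;e_i,y_2,\dots)$ for an orthonormal basis $(e_i)$, $c^r$ its $r$-th iterate. $\langle\cdot,\cdot\rangle$ is the inner product for which the $e_I^*\otimes e_J^*$ ($I,J$ increasing multi-indices) are orthonormal, $|\cdot|$ its norm. $R$ is regarded as a $(2,2)$ double form with $R(x,y;x,y)$ the sectional curvature for orthonormal $x,y$, so $cR=Ric$, $c^2R=Scal$. The $(2k)$-th Gauss–Bonnet curvature is $h_{2k}=\frac{c^{2k}R^k}{(2k)!}$ for $0\le 2k\le n$ (so $h_2=\frac12Scal$). *)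

(* Defs.v *)
From HB Require Import structures.
From mathcomp Require Import all_boot all_order all_algebra.
From mathcomp Require Import all_classical all_reals all_analysis.

Set Implicit Arguments.
Unset Strict Implicit.
Unset Printing Implicit Defensive.

Import Order.TTheory GRing.Theory Num.Theory.
Import numFieldNormedType.Exports.

Local Open Scope classical_set_scope.
Local Open Scope ring_scope.

Section Smooth.
Variables (R : realType) (n : nat).

Definition partial (i : 'I_n) (f : 'rV[R]_n -> R) (u : 'rV[R]_n) : R :=
  'D_(delta_mx 0 i) f u.

Fixpoint Ck_on (k : nat) (U : set 'rV[R]_n) (f : 'rV[R]_n -> R) : Prop :=
  (forall u, U u -> {for u, continuous f}) /\
  if k is k'.+1 then
    forall i : 'I_n, (forall u, U u -> derivable f u (delta_mx 0 i)) /\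
                     Ck_on k' U (partial i f)
  else True.

Definition smooth_on (U : set 'rV[R]_n) (f : 'rV[R]_n -> R) : Prop :=
  forall k, Ck_on k U f.

End Smooth.

(* A smooth manifold of dimension n, given by a (not necessarily maximal)
   smooth atlas.  [chart_map c] is only meaningful on the open set
   [chart_dom c], and its inverse [chart_inv c] only on the image of
   [chart_dom c]; transition maps are smooth in both directions because c and d
   are both arbitrary in [transition_smooth]. *)
Record smooth_manifold (R : realType) (n : nat) := SmoothManifold {
  carrier :> topologicalType ;
  chart : Type ;
  chart_dom : chart -> set carrier ;
  chart_map : chart -> carrier -> 'rV[R]_n ;
  chart_inv : chart -> 'rV[R]_n -> carrier ;
  carrier_hausdorff : hausdorff_space carrier ;
  carrier_second_countable : @second_countable carrier ;
  chart_dom_cover : forall p : carrier, exists c, chart_dom c p ;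
  chart_dom_open : forall c, open (chart_dom c) ;
  chart_image_open : forall c, open (chart_map c @` chart_dom c) ;
  chart_mapK : forall c p, chart_dom c p -> chart_inv c (chart_map c p) = p ;
  chart_map_continuous : forall c p, chart_dom c p ->
    {for p, continuous (chart_map c)} ;
  chart_inv_continuous : forall c u, (chart_map c @` chart_dom c) u ->
    {for u, continuous (chart_inv c)} ;
  transition_smooth : forall (c d : chart) (j : 'I_n),
    smooth_on (chart_map c @` (chart_dom c `&` chart_dom d))
      (fun u => chart_map d (chart_inv c u) 0 j)
}.

Definition inner_prod (R : realType) (n : nat) (G : 'M[R]_n)
  (v w : 'rV[R]_n) : R := (v *m G *m w^T) 0 0.

(* [gram c u] is the matrix g(d_i, d_j) at the point with coordinates u in the
   chart c.  Tangent vectors are row vectors of components in the coordinate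
   frame, so that v becomes v *m jacobian _ u under a change of chart. *)
Record riemannian_metric (R : realType) (n : nat) (M : smooth_manifold R n) :=
  RiemannianMetric {
  gram : chart M -> 'rV[R]_n -> 'M[R]_n ;
  gram_smooth : forall (c : chart M) (i j : 'I_n),
    smooth_on (chart_map c @` chart_dom c) (fun u => gram c u i j) ;
  gram_sym : forall (c : chart M) u, (chart_map c @` chart_dom c) u ->
    (gram c u)^T = gram c u ;
  gram_posdef : forall (c : chart M) u v, (chart_map c @` chart_dom c) u ->
    v != 0 -> 0 < inner_prod (gram c u) v v ;
  gram_change : forall (c d : chart M) (p : M), chart_dom c p -> chart_dom d p ->
    let J := jacobian (fun u => chart_map d (chart_inv c u)) (chart_map c p) in
    gram c (chart_map c p) = J *m gram d (chart_map d p) *m J^T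
}.

Section Curvature.
Variables (R : realType) (n : nat) (G : 'rV[R]_n -> 'M[R]_n).

(* Gamma^k_ij of the Levi-Civita connection *)
Definition christoffel (k i j : 'I_n) (u : 'rV[R]_n) : R :=
  2%:R^-1 * \sum_(l < n) invmx (G u) k l *
    (partial i (fun v => G v j l) u + partial j (fun v => G v i l) u
     - partial l (fun v => G v i j) u).

(* The component along d_l of R(d_i, d_j) d_k, where
   R(X, Y) Z = nabla_X nabla_Y Z - nabla_Y nabla_X Z - nabla_[X, Y] Z. *)
Definition riemann_comp (l k i j : 'I_n) (u : 'rV[R]_n) : R :=
  partial i (christoffel l j k) u - partial j (christoffel l i k) u
  + \sum_(m < n) (christoffel l i m u * christoffel m j k u
                  - christoffel l j m u * christoffel m i k u).

Definition riemann_op (u x y z : 'rV[R]_n) : 'rV[R]_n :=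
  \row_l \sum_(i < n) \sum_(j < n) \sum_(k < n)
    x 0 i * y 0 j * z 0 k * riemann_comp l k i j u.

End Curvature.

(* A (p,q) double form on a vector space V is an element of
   Lambda^p V^* (x) Lambda^q V^*, i.e. a function on V^p x V^q that is
   multilinear and alternating in each group of arguments.  The two groups are
   given as sequences and the function is extended by 0 to sequences of other
   lengths, so that double forms of all bidegrees share the type [dform V]. *)
Definition dform (R : realType) (V : Type) := seq V -> seq V -> R.

Section DoubleForms.
Variables (R : realType) (V : Type).
Implicit Types omega theta : dform R V.

Definition subfamily (xs : seq V) (A : {set 'I_(size xs)}) : seq V :=
  [seq tnth (in_tuple xs) i | i in A].

(* number of inversions of the shuffle that lists A, then its complement *)
Definition inversions (m : nat) (A : {set 'I_m}) : nat :=
  #|[set ij : 'I_m * 'I_m |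
      [&& ij.1 \in A, ij.2 \notin A & (ij.2 < ij.1)%N]]|.

Definition form_wedge (a b : seq V -> R) (xs : seq V) : R :=
  \sum_(A : {set 'I_(size xs)})
    (-1) ^+ inversions A * a (subfamily A) * b (subfamily (~: A)).

Definition form_tensor (a b : seq V -> R) : dform R V := fun xs ys => a xs * b ys.

(* The bilinear extension of (a1 (x) b1)(a2 (x) b2) = (a1 /\ a2) (x) (b1 /\ b2);
   see [dmul_tensor]. *)
Definition dmul omega theta : dform R V := fun xs ys =>
  \sum_(A : {set 'I_(size xs)}) \sum_(B : {set 'I_(size ys)})
    (-1) ^+ inversions A * (-1) ^+ inversions B *
    omega (subfamily A) (subfamily B) *
    theta (subfamily (~: A)) (subfamily (~: B)).

Lemma dmul_tensor (a1 b1 a2 b2 : seq V -> R) xs ys :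
  dmul (form_tensor a1 b1) (form_tensor a2 b2) xs ys =
  form_tensor (form_wedge a1 a2) (form_wedge b1 b2) xs ys.
Proof.
rewrite /dmul /form_tensor /form_wedge big_distrlr /=.
apply: eq_bigr => A _; apply: eq_bigr => B _.
by rewrite [X in X * _ = _]mulrACA [LHS]mulrACA.
Qed.

Definition dform_one : dform R V := fun xs ys => (nilp xs && nilp ys)%:R.

Definition dpow omega (k : nat) : dform R V := iter k (dmul omega) dform_one.

Definition form_scale (a : R) omega : dform R V := fun xs ys => a * omega xs ys.

Variables (n : nat) (e : 'I_n -> V).

(* contraction, for the inner product in which the basis e is orthonormal *)
Definition dcontract omega : dform R V := fun xs ys =>
  \sum_(i < n) omega (e i :: xs) (e i :: ys).

(* The inner product in which the e_I^* (x) e_J^* are orthonormal: the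
   coefficient of omega on e_I^* (x) e_J^* is omega(e_I; e_J), where e_I lists
   the vectors of index in I in increasing order. *)
Definition dinner omega theta : R :=
  \sum_(I : {set 'I_n}) \sum_(J : {set 'I_n})
    omega [seq e i | i in I] [seq e j | j in J] *
    theta [seq e i | i in I] [seq e j | j in J].

Definition dnorm omega : R := Num.sqrt (dinner omega omega).

(* [gauss_bonnet omega k] is h_{2k}, when omega is the Riemann form_tensor *)
Definition gauss_bonnet omega (k : nat) : R :=
  iter (2 * k) dcontract (dpow omega k) [::] [::] / (2 * k)`!%:R.

End DoubleForms.

Definition orthonormal_frame (R : realType) (n : nat) (G : 'M[R]_n)
  (e : 'I_n -> 'rV[R]_n) : Prop :=
  forall i j : 'I_n, inner_prod G (e i) (e j) = (i == j)%:R.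

(* The Riemann form_tensor at p as a (2,2) double form, in the coordinates of c:
   R(x, y; z, w) = g(R(x, y) w, z), so that R(x, y; x, y) is the sectional
   curvature when x, y are orthonormal. *)
Definition riemann (R : realType) (n : nat) (M : smooth_manifold R n)
  (g : riemannian_metric M) (c : chart M) (p : M) : dform R 'rV[R]_n :=
  fun xs ys =>
    match xs, ys with
    | [:: x; y], [:: z; w] =>
        inner_prod (gram g c (chart_map c p))
          (riemann_op (gram g c) (chart_map c p) x y w) z
    | _, _ => 0
    end.

(* Main.v *)
Require Import Defs.
From mathcomp Require Import all_boot all_order all_algebra.
From mathcomp Require Import all_classical all_reals all_analysis.
From mathcomp Require Import ring lra.

(** The identity is pointwise and multilinear, so it is read off in the frame
    [e]: a double form becomes a function of two sequences of indices,
    alternating in each.  Write eps_i for the exterior multiplication by the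
    i-th dual covector and iota_i for the insertion of the i-th frame vector,
    both in the first group of arguments, and eps'_i, iota'_i for the same
    operators in the second group.  They satisfy
    iota_j eps_i + eps_i iota_j = delta_ij, the primed and the unprimed ones
    commute, and the contraction is c = sum_i iota_i iota'_i.  Hence
    c eps_i = iota'_i - eps_i c ([contract_extl]).  As eps_i Phi vanishes on the
    empty sequence, iterating this gives, for alternating Phi and for the value on
    empty sequences,
      c^m (eps_i Phi) = m c^(m-1) (iota'_i Phi)   ([trace_extl]):
    under a full contraction, a covector on one side may be traded for an
    insertion on the other side.

    Since R Omega = 1/4 sum R_ijkl eps_i eps_j eps'_k eps'_l Omega
    ([dmul_curvature]), two such trades turn c^m (R Omega) into
    contractions of iota'_j iota'_i eps'_k eps'_l Omega.  Moving the insertions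
    to the right ([trace_wick]) sorts the terms by the number of Kronecker
    deltas that appear.  With two deltas, R_ijkl becomes the scalar curvature
    and multiplies c^(m-2) Omega; with one, it becomes the Ricci tensor and is
    paired with c^(m-3) Omega; with none, R itself is paired with c^(m-4) Omega
    ([trace_dmul_curvature]).  For Omega = R^k and m = 2k+2, the numerical
    factors produced by the trades are exactly the ratios of the factorials in
    the definition of the Gauss-Bonnet curvatures ([gauss_bonnet_recursion]).
    For k = 1 the two pairings are squared norms, and h_2 = c^2 R / 2.

    In the terms with at most one delta, the indices of R come out on the
    opposite sides of Omega, so the symmetry R_ijkl = R_klij is essential
    ([riemann_pairC]).  It is proved in the chart: after lowering an index, the
    curvature is a combination of second derivatives of the metric plus terms
    bilinear in the Christoffel symbols.  The latter are visibly symmetric, and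
    the former are because mixed second derivatives commute ([schwarz]).  *)

Set Implicit Arguments.
Unset Strict Implicit.
Unset Printing Implicit Defensive.
Import Order.TTheory GRing.Theory Num.Theory.
Import numFieldNormedType.Exports.

Local Open Scope ring_scope.

(** * Mixed second derivatives *)

Section Schwarz.
Local Open Scope classical_set_scope.
Variables (R : realType) (n : nat).
Implicit Types (f : 'rV[R]_n -> R) (u v w : 'rV[R]_n).

(** Restricting to a line turns a directional derivative into a derivative of a
    function of one real variable, to which the mean value theorem applies. *)
Lemma is_derive_line f v w (s : R) :
  derivable f (v + s *: w) w ->
  is_derive s (1 : R) (fun t => f (v + t *: w)) ('D_w f (v + s *: w)).
Proof.
move=> df.
have E : (fun h : R => h^-1 *: ((f \o shift (v + s *: w)) (h *: w) - f (v + s *: w)))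
  = (fun h : R => h^-1 *: (((fun t => f (v + t *: w)) \o shift s) (h *: 1) - f (v + s *: w))).
  apply/funext => h /=; rewrite /shift /=.
  by rewrite [h%:A]mulr1 scalerDl addrCA.
split.
  by move: df; rewrite /derivable /= E.
by rewrite /derive /= E.
Qed.

Lemma mvt_line f v w (h : R) : 0 < h ->
  (forall t, 0 <= t <= h -> derivable f (v + t *: w) w) ->
  exists2 t, 0 < t < h & f (v + h *: w) - f v = h * 'D_w f (v + t *: w).
Proof.
move=> h0 df.
have [] := @MVT R (fun t => f (v + t *: w)) (fun t => 'D_w f (v + t *: w)) 0 h h0.
- move=> t; rewrite in_itv /= => /andP[t0 th]; apply: is_derive_line.
  by apply: df; rewrite !ltW.
- apply: derivable_within_continuous => t; rewrite in_itv /= => th.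
  by have [] := is_derive_line (df t th).
- move=> t; rewrite in_itv /= => th; rewrite subr0 scale0r addr0 => ->.
  by exists t => //; rewrite mulrC.
Qed.

(** The mean value theorem, applied first to the difference of two parallel
    slices of [f] in the direction [a], then in the direction [b].  The left-hand
    side is symmetric in [a] and [b], which is what makes mixed derivatives
    commute. *)
Lemma second_difference f u a b (h : R) : 0 < h ->
  (forall s t, 0 <= s <= h -> 0 <= t <= h ->
     derivable f (u + s *: a + t *: b) a /\
     derivable ('D_a f) (u + s *: a + t *: b) b) ->
  exists s t, [/\ 0 <= s <= h, 0 <= t <= h &
    f (u + h *: a + h *: b) - f (u + h *: a) - f (u + h *: b) + f u =
    h * (h * 'D_b ('D_a f) (u + s *: a + t *: b))].
Proof.
move=> h0 df.
have itvW t : 0 < t < h -> 0 <= t <= h by move=> /andP[? ?]; rewrite !ltW.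
have hh : 0 <= h <= h by rewrite ltW /=.
have h00 : 0 <= (0 : R) <= h by rewrite lexx ltW.
pose g s := f (u + h *: b + s *: a) - f (u + s *: a).
have dg s : 0 <= s <= h -> is_derive s (1 : R) g
    ('D_a f (u + h *: b + s *: a) - 'D_a f (u + s *: a)).
  move=> sh; apply: is_deriveB; apply: is_derive_line.
    by rewrite [u + h *: b + _]addrAC; exact: (df s h sh hh).1.
  by have [+ _] := df s 0 sh h00; rewrite scale0r addr0.
have [] := @MVT R g (fun s => 'D_a f (u + h *: b + s *: a) - 'D_a f (u + s *: a)) 0 h h0.
- by move=> s; rewrite in_itv /= => /itvW; exact: dg.
- apply: derivable_within_continuous => s; rewrite in_itv /= => sh.
  by have [] := dg s sh.
move=> s; rewrite in_itv /= => /itvW sh; rewrite subr0 => Eg.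
have [t /itvW th Et] := mvt_line (f := 'D_a f) (v := u + s *: a) h0
  (fun t th => (df s t sh th).2).
exists s, t; split => //; rewrite -Et mulrC.
rewrite [u + s *: a + _]addrAC -Eg /g scale0r !addr0.
rewrite [u + h *: b + _]addrAC; ring.
Qed.

(** By [second_difference], both mixed derivatives, each taken at some point of
    an arbitrarily small parallelogram at [u], have the same value; continuity
    brings both points to [u]. *)
Lemma schwarz f (U : set 'rV[R]_n) u (i j : 'I_n) :
  open U -> U u -> Ck_on 2 U f ->
  partial i (partial j f) u = partial j (partial i f) u.
Proof.
move=> oU Uu [_ C2].
pose a : 'rV[R]_n := delta_mx 0 i; pose b : 'rV[R]_n := delta_mx 0 j.
have [da /= [_ C2i]] := C2 i; have [db [_ C2j]] := C2 j.
have [dab [cab _]] := C2i j; have [dba [cba _]] := C2j i.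
apply/eqP; rewrite -subr_eq0 -normr_le0; apply/ler_addgt0Pl => eps eps0.
rewrite addr0.
have e2 : 0 < eps / 2 by rewrite divr_gt0.
have : \forall w \near u, [/\ U w, `|partial i (partial j f) u - partial i (partial j f) w| < eps / 2 & `|partial j (partial i f) u - partial j (partial i f) w| < eps / 2].
  have n1 := open_nbhs_nbhs (conj oU Uu).
  have n2 := @cvgr_dist_lt _ _ _ _ _ _ _ (cba u Uu) _ e2.
  have n3 := @cvgr_dist_lt _ _ _ _ _ _ _ (cab u Uu) _ e2.
  apply: filterS3 n1 (n2 _) (n3 _) => w a1 a2 a3; exact: (And3 a1 a2 a3).
move=> /nbhs_ballP[r /= r0 Br].
(* The parallelogram with sides [h *: a] and [h *: b] lies in the ball of
   radius [r]. *)
pose h := r / 2 / (1 + `|a| + `|b|).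
have D0 : 0 < 1 + `|a| + `|b| by rewrite -addrA ltr_pwDl// addr_ge0.
have h0 : 0 < h by rewrite !divr_gt0.
have box s t : 0 <= s <= h -> 0 <= t <= h -> ball u r (u + s *: a + t *: b).
  move=> /andP[s0 sh] /andP[t0 th]; rewrite -ball_normE /=.
  rewrite -addrA opprD addNKr normrN (le_lt_trans (ler_normD _ _))// !normrZ.
  rewrite !ger0_norm//.
  have: s * `|a| + t * `|b| <= h * (1 + `|a| + `|b|).
    rewrite -addrA mulrDr mulr1 mulrDr; apply: ler_wpDl; first exact: ltW.
    by rewrite lerD// ler_wpM2r.
  rewrite /h divfK ?gt_eqF// => /le_lt_trans; apply.
  by rewrite ltr_pdivrMr// ltr_pMr// ltr1n.
have [s1 [t1 [s1h t1h E1]]] : exists s t, [/\ 0 <= s <= h, 0 <= t <= h &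
    f (u + h *: a + h *: b) - f (u + h *: a) - f (u + h *: b) + f u =
    h * (h * partial j (partial i f) (u + s *: a + t *: b))].
  apply: second_difference => // s t sh th.
  by have [Uw _ _] := Br _ (box s t sh th); exact: (conj (da _ Uw) (dab _ Uw)).
have [s2 [t2 [s2h t2h E2]]] : exists s t, [/\ 0 <= s <= h, 0 <= t <= h &
    f (u + h *: b + h *: a) - f (u + h *: b) - f (u + h *: a) + f u =
    h * (h * partial i (partial j f) (u + s *: b + t *: a))].
  apply: second_difference => // s t sh th.
  have [Uw _ _] := Br _ (box t s th sh); rewrite addrAC.
  exact: (conj (db _ Uw) (dba _ Uw)).
have [_ _ B1] := Br _ (box _ _ s1h t1h).
have [_ B2 _] := Br _ (box _ _ t2h s2h).
rewrite [u + h *: b + _]addrAC [u + s2 *: b + _]addrAC in E2.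
move: B1 B2 E1 E2.
move: (partial j _ (_ + _)) (partial i _ (_ + _)) => X Y.
move: (partial j _ _) (partial i _ _) => p q; clear -h0 => B1 B2 E1 E2.
have XY : X = Y.
  apply: (mulfI (lt0r_neq0 h0)); apply: (mulfI (lt0r_neq0 h0)).
  by rewrite -E1 -E2; ring.
rewrite (le_trans (ler_distD Y _ _))// (splitr eps) lerD ?ltW//.
by rewrite distrC -XY.
Qed.
End Schwarz.

(** * The curvature tensor in a chart *)

Section PartialCalculus.
Local Open Scope classical_set_scope.
Variables (R : realType) (V : normedModType R) (x v : V).

Lemma derivable_bigsum (I : Type) (r : seq I) (F : I -> V -> R) :
  (forall i, derivable (F i) x v) -> derivable (fun u => \sum_(i <- r) F i u) x v.
Proof.
move=> dF; elim: r => [|i r IH].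
  under eq_fun do rewrite big_nil; exact: derivable_cst.
under eq_fun do rewrite big_cons; exact: (derivableD (dF i) IH).
Qed.

Lemma derivable_bigprod (I : Type) (r : seq I) (F : I -> V -> R) :
  (forall i, derivable (F i) x v) -> derivable (fun u => \prod_(i <- r) F i u) x v.
Proof.
move=> dF; elim: r => [|i r IH].
  under eq_fun do rewrite big_nil; exact: derivable_cst.
under eq_fun do rewrite big_cons; exact: (derivableM (dF i) IH).
Qed.

Lemma derivable_det n (A : V -> 'M[R]_n) :
  (forall i j, derivable (fun u => A u i j) x v) ->
  derivable (fun u => \det (A u)) x v.
Proof.
move=> dA; apply: derivable_bigsum => s.
by apply: derivableM; [exact: derivable_cst | exact: derivable_bigprod].
Qed.

(** By Cramer's rule the entries of the inverse are quotients of
    determinants. *)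
Lemma derivable_invmx n (A : V -> 'M[R]_n) (i j : 'I_n) :
  (\near x, A x \in unitmx) ->
  (forall i j, derivable (fun u => A u i j) x v) ->
  derivable (fun u => invmx (A u) i j) x v.
Proof.
move=> uA dA.
apply: (@near_eq_derivable _ _ _ (fun u => (\det (A u))^-1 * cofactor (A u) j i)).
  near=> w; rewrite /invmx ifT; first by rewrite !mxE.
  by near: w.
apply: derivableM.
  apply: derivableV; last exact: derivable_det.
  by rewrite -unitfE -unitmxE; exact: nbhs_singleton uA.
apply: derivableM; first exact: derivable_cst.
apply: derivable_det => k l; under eq_fun do rewrite !mxE; exact: dA.
Unshelve. all: by end_near. Qed.

End PartialCalculus.

Section Christoffel.
Local Open Scope classical_set_scope.
Variables (R : realType) (n : nat) (U : set 'rV[R]_n) (G : 'rV[R]_n -> 'M[R]_n).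
Hypothesis openU : open U.
Hypothesis smoothG : forall i j, smooth_on U (fun u => G u i j).
Hypothesis symG : forall u, U u -> (G u)^T = G u.
Hypothesis unitG : forall u, U u -> G u \in unitmx.

Lemma near_domain u (P : 'rV[R]_n -> Prop) :
  (forall w, U w -> P w) -> U u -> \near u, P u.
Proof. by move=> UP Uu; near=> w; apply: UP; near: w; exact: open_nbhs_nbhs. Unshelve. all: by end_near. Qed.

Lemma eq_partial i f g u :
  (forall w, U w -> f w = g w) -> U u -> partial i f u = partial i g u.
Proof. by move=> fg Uu; apply: near_eq_derive; exact: near_domain. Qed.

Lemma gramC u i j : U u -> G u i j = G u j i.
Proof. by move=> Uu; rewrite -{1}(symG Uu) mxE. Qed.

Lemma derivable_gram u i j k : U u ->
  derivable (fun w => G w i j) u (delta_mx 0 k).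
Proof. by have [_ C1] := smoothG i j 1 => Uu; exact: (C1 k).1. Qed.

Lemma derivable_partial_gram u i j k l : U u ->
  derivable (partial l (fun w => G w i j)) u (delta_mx 0 k).
Proof. by have [_ C2] := smoothG i j 2 => Uu; have [_ [_ C1]] := C2 l; exact: (C1 k).1. Qed.

(** The Christoffel symbols of the first kind, with the lowered index in front. *)
Definition christoffel1 (s i j : 'I_n) (u : 'rV[R]_n) : R :=
  2%:R^-1 * (partial i (fun w => G w j s) u + partial j (fun w => G w i s) u
             - partial s (fun w => G w i j) u).

Lemma partial_gramC u i j k : U u ->
  partial k (fun w => G w i j) u = partial k (fun w => G w j i) u.
Proof. by apply: eq_partial => w; exact: gramC. Qed.

Lemma christoffelC k i j u : U u -> christoffel G k i j u = christoffel G k j i u.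
Proof.
move=> Uu; congr (_ * _); apply: eq_bigr => l _; congr (_ * _).
by rewrite (partial_gramC i j l Uu) [X in X - _]addrC.
Qed.

Lemma christoffel1E s i j u : U u ->
  christoffel1 s i j u = \sum_k G u s k * christoffel G k i j u.
Proof.
move=> Uu; rewrite /christoffel1 /christoffel.
under eq_bigr do rewrite mulrCA mulr_sumr.
rewrite -mulr_sumr exchange_big /=; congr (_ * _).
pose F l := partial i (fun w => G w j l) u + partial j (fun w => G w i l) u
             - partial l (fun w => G w i j) u.
transitivity (\sum_l (G u *m invmx (G u)) s l * F l).
  rewrite mulmxV ?unitG// (bigD1 s)//= mxE eqxx mul1r big1 ?addr0// => l ls.
  by rewrite mxE eq_sym (negPf ls) mul0r.
apply: eq_bigr => l _; rewrite mxE mulr_suml.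
by apply: eq_bigr => k _; rewrite mulrA.
Qed.

Lemma derivable_christoffel k i j l u : U u ->
  derivable (christoffel G k i j) u (delta_mx 0 l).
Proof.
move=> Uu; apply: derivableM; first exact: derivable_cst.
apply: derivable_bigsum => m; apply: derivableM.
  apply: derivable_invmx => [|a b]; last exact: derivable_gram.
  by apply: near_domain => // w; exact: unitG.
by apply: derivableB; [apply: derivableD|]; exact: derivable_partial_gram.
Qed.

(** The connection is compatible with the metric. *)
Lemma partial_gram u i j k : U u ->
  partial k (fun w => G w i j) u = christoffel1 i k j u + christoffel1 j k i u.
Proof.
move=> Uu; rewrite /christoffel1 (partial_gramC j i k Uu).
by field.
Qed.

Lemma partial_combination l (a : R) (f g h : 'rV[R]_n -> R) u :
  derivable f u (delta_mx 0 l) -> derivable g u (delta_mx 0 l) ->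
  derivable h u (delta_mx 0 l) ->
  partial l (fun w => a * (f w + g w - h w)) u =
  a * (partial l f u + partial l g u - partial l h u).
Proof.
move=> df dg dh; have dfg := derivableD df dg.
by rewrite /partial (deriveZ a (derivableB dfg dh)) (deriveB dfg dh) (deriveD df dg).
Qed.

Lemma partial_christoffel1 l s i j u : U u ->
  partial l (christoffel1 s i j) u =
  2%:R^-1 * (partial l (partial i (fun w => G w j s)) u
     + partial l (partial j (fun w => G w i s)) u
     - partial l (partial s (fun w => G w i j)) u).
Proof.
by move=> Uu; apply: partial_combination; exact: derivable_partial_gram.
Qed.

(** Leibniz rule for [christoffel1E], where the derivative of the metric is
    expressed by Christoffel symbols.  This differentiates the symbols of the
    second kind without differentiating the inverse of the Gram matrix. *)
Lemma partial_christoffel l s i j u : U u ->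
  \sum_k G u s k * partial l (christoffel G k i j) u =
  partial l (christoffel1 s i j) u
  - \sum_k (christoffel1 s l k u + christoffel1 k l s u) * christoffel G k i j u.
Proof.
move=> Uu; apply/eqP; rewrite -subr_eq opprK; apply/eqP; symmetry.
have -> : partial l (christoffel1 s i j) u =
  partial l (fun w => \sum_k G w s k * christoffel G k i j w) u.
  by apply: eq_partial => // w; exact: christoffel1E.
have -> : (fun w => \sum_k G w s k * christoffel G k i j w) =
  \sum_k ((fun w => G w s k) * christoffel G k i j).
  by apply/funext => w; rewrite fct_sumE.
rewrite /partial derive_sum; last first.
  by move=> k; apply: derivableM; [exact: derivable_gram | exact: derivable_christoffel].
rewrite -big_split /=; apply: eq_bigr => k _.
rewrite deriveM; [|exact: derivable_gram|exact: derivable_christoffel].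
congr (_ + _); rewrite [LHS]mulrC; congr (_ * _); exact: partial_gram.
Qed.

(** The component g(R(d_i, d_j) d_l, d_k). *)
Definition riemann_low (k l i j : 'I_n) (u : 'rV[R]_n) : R :=
  \sum_a G u k a * riemann_comp G a l i j u.

(** Half of the terms of [partial_christoffel] cancel against the quadratic
    terms of the curvature; the others pair the symbols of the first kind with
    those of the second kind, a pairing that is symmetric by
    [christoffel_pairingC]. *)
Lemma riemann_lowE k l i j u : U u ->
  riemann_low k l i j u =
    partial i (christoffel1 k j l) u - partial j (christoffel1 k i l) u
    - \sum_a christoffel1 a i k u * christoffel G a j l u
    + \sum_a christoffel1 a j k u * christoffel G a i l u.
Proof.
move=> Uu.
transitivity (\sum_a G u k a * partial i (christoffel G a j l) u
   - \sum_a G u k a * partial j (christoffel G a i l) u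
   + \sum_m (christoffel1 k i m u * christoffel G m j l u
             - christoffel1 k j m u * christoffel G m i l u)).
  have -> : \sum_m (christoffel1 k i m u * christoffel G m j l u
             - christoffel1 k j m u * christoffel G m i l u) =
      \sum_a G u k a * \sum_m (christoffel G a i m u * christoffel G m j l u
             - christoffel G a j m u * christoffel G m i l u).
    under [RHS]eq_bigr do rewrite mulr_sumr.
    rewrite exchange_big /=; apply: eq_bigr => m _.
    rewrite (christoffel1E k i m Uu) (christoffel1E k j m Uu) !mulr_suml -sumrB.
    by apply: eq_bigr => a _; rewrite mulrBr !mulrA.
  rewrite -sumrB -big_split /=; apply: eq_bigr => a _.
  by rewrite -mulrBr -mulrDr.
rewrite [X in X - _ + _ = _](partial_christoffel i k j l Uu).
rewrite [X in _ - X + _ = _](partial_christoffel j k i l Uu).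
move: (partial i _ _) (partial j _ _) => x y.
rewrite sumrB.
under [X in _ - X - _ + _]eq_bigr do rewrite mulrDl.
under [X in _ - (_ - X) + _]eq_bigr do rewrite mulrDl.
have combine (p q r t : R) : x - (p + q) - (y - (r + t)) + (p - r) = x - y - q + t by ring.
rewrite !big_split; exact: combine.
Qed.

Lemma christoffel_pairingC i k j l u : U u ->
  \sum_a christoffel1 a i k u * christoffel G a j l u =
  \sum_a christoffel1 a j l u * christoffel G a i k u.
Proof.
move=> Uu; under eq_bigr do rewrite christoffel1E// mulr_suml.
under [RHS]eq_bigr do rewrite christoffel1E// mulr_suml.
rewrite exchange_big /=; apply: eq_bigr => a _; apply: eq_bigr => b _.
by rewrite (gramC b a Uu) mulrAC.
Qed.

Lemma christoffel1C s i j u : U u -> christoffel1 s i j u = christoffel1 s j i u.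
Proof.
move=> Uu; rewrite (christoffel1E s i j Uu) (christoffel1E s j i Uu).
by apply: eq_bigr => k _; rewrite (christoffelC k i j Uu).
Qed.

(** Each side is a combination of second derivatives of the metric; the two
    agree once mixed derivatives are exchanged. *)
Lemma partial_christoffel1_pairC k l i j u : U u ->
  partial i (christoffel1 k j l) u - partial j (christoffel1 k i l) u =
  partial k (christoffel1 i l j) u - partial l (christoffel1 i k j) u.
Proof.
move=> Uu.
have sw a b c d : partial a (partial b (fun w => G w c d)) u =
  partial b (partial a (fun w => G w c d)) u.
  exact: (schwarz a b openU Uu (smoothG c d 2)).
have gc a b c d : partial a (partial b (fun w => G w c d)) u =
  partial a (partial b (fun w => G w d c)) u.
  by apply: eq_partial => // w Uw; exact: partial_gramC.
rewrite (partial_christoffel1 i k j l Uu) (partial_christoffel1 j k i l Uu).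
rewrite (partial_christoffel1 k i l j Uu) (partial_christoffel1 l i k j Uu).
have reorder (H : 'I_n -> 'I_n -> 'I_n -> 'I_n -> R) :
    (forall a b c d, H a b c d = H b a c d) ->
    (forall a b c d, H a b c d = H a b d c) ->
    2%:R^-1 * (H i j l k + H i l j k - H i k j l)
    - 2%:R^-1 * (H j i l k + H j l i k - H j k i l) =
    2%:R^-1 * (H k l j i + H k j l i - H k i l j)
    - 2%:R^-1 * (H l k j i + H l j k i - H l i k j).
  move=> s1 s2; rewrite (s1 j i l k) (s1 l k j i) (s1 k j l i) (s2 j k l i).
  by rewrite (s1 k i l j) (s2 i k l j) (s1 l j k i) (s2 j l k i) (s1 l i k j) (s2 i l k j); ring.
exact: (reorder (fun a b c d => partial a (partial b (fun w => G w c d)) u)).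
Qed.

Lemma riemann_low_pairC k l i j u : U u ->
  riemann_low k l i j u = riemann_low i j k l u.
Proof.
move=> Uu; rewrite (riemann_lowE k l i j Uu) (riemann_lowE i j k l Uu).
have Q a b c d : \sum_e christoffel1 e a b u * christoffel G e c d u =
    \sum_e christoffel1 e b a u * christoffel G e d c u.
  apply: eq_bigr => e _.
  by rewrite (christoffel1C e a b Uu) (christoffelC e c d Uu).
rewrite [X in X - _ + _ = _](partial_christoffel1_pairC k l i j Uu).
rewrite [X in _ - X + _ = _]Q.
by rewrite [X in _ + X = _](christoffel_pairingC j k i l Uu) [X in _ + X = _]Q.
Qed.
End Christoffel.

Lemma sum_pairC (V : nmodType) (I : finType) (F : I -> I -> I -> I -> V) :
  \sum_i \sum_j \sum_k \sum_l F i j k l = \sum_k \sum_l \sum_i \sum_j F i j k l.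
Proof.
under eq_bigr do rewrite exchange_big.
rewrite exchange_big /=; apply: eq_bigr => k _.
by under eq_bigr do rewrite exchange_big; rewrite exchange_big.
Qed.

Section RiemannTensor.
Local Open Scope classical_set_scope.
Variables (R : realType) (n : nat) (M : smooth_manifold R n).
Variables (g : riemannian_metric M) (c : chart M) (p : M).
Local Notation G := (gram g c).
Local Notation u := (chart_map c p).
Local Notation U := (chart_map c @` chart_dom c).

Lemma riemann_antisym x y zs :
  riemann g c p [:: y; x] zs = - riemann g c p [:: x; y] zs.
Proof.
case: zs => [|z [|w [|? ?]]] /=; rewrite ?oppr0//.
have -> : riemann_op G u y x w = - riemann_op G u x y w.
  apply/rowP => l; rewrite !mxE -sumrN exchange_big /=; apply: eq_bigr => i _.
  rewrite -sumrN; apply: eq_bigr => j _; rewrite -sumrN; apply: eq_bigr => k _.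
  rewrite /riemann_comp [y 0 j * _]mulrC -!mulrN; congr (_ * _).
  rewrite !sumrB.
  by move: (partial _ _ _) (partial _ _ _) (\sum_m _) (\sum_m _) => *; ring.
by rewrite /inner_prod !mulNmx mxE.
Qed.

Lemma gram_unit w : U w -> G w \in unitmx.
Proof.
move=> Uw; rewrite -row_free_unit; apply/inj_row_free => v vG.
apply: contraTeq isT => /(gram_posdef g Uw).
by rewrite /inner_prod vG mul0mx mxE ltxx.
Qed.

Hypothesis hp : chart_dom c p.

Let Uu : U u. Proof. by exists p. Qed.

Lemma riemannE x y z w : riemann g c p [:: x; y] [:: z; w] =
  \sum_i \sum_j \sum_k \sum_l
     x 0 i * y 0 j * z 0 k * w 0 l * riemann_low G k l i j u.
Proof.
under [RHS]eq_bigr do rewrite exchange_big.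
rewrite [RHS]exchange_big /= /inner_prod mxE; apply: eq_bigr => k _.
rewrite !mxE mulr_suml.
under [RHS]eq_bigr do under eq_bigr do
  (under eq_bigr do rewrite /riemann_low mulr_sumr; rewrite exchange_big).
under [RHS]eq_bigr do rewrite exchange_big.
rewrite [RHS]exchange_big /=; apply: eq_bigr => a _.
rewrite !mxE !mulr_suml; apply: eq_bigr => i _.
rewrite !mulr_suml; apply: eq_bigr => j _.
rewrite !mulr_suml; apply: eq_bigr => l _.
have -> : G u a k = G u k a by rewrite -{1}(gram_sym g Uu) mxE.
by move: (riemann_comp _ _ _ _ _ _) => r; ring.
Qed.

Lemma riemann_pairC x y z w :
  riemann g c p [:: x; y] [:: z; w] = riemann g c p [:: z; w] [:: x; y].
Proof.
rewrite !riemannE sum_pairC.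
do 4![apply: eq_bigr => ? _].
rewrite (@riemann_low_pairC _ _ U)//; last 4 first.
- exact: chart_image_open.
- exact: gram_smooth.
- exact: gram_sym.
- exact: gram_unit.
by move: (riemann_low _ _ _ _ _ _) => r; ring.
Qed.
End RiemannTensor.

(** * Products as sums over shuffles *)

Section SubsetRecursion.
Variable m : nat.
Implicit Types (A : {set 'I_m.+1}) (B : {set 'I_m}).

Local Notation pred_set A := (lift ord0 @^-1: A).

Lemma enum_ordS_set A : enum A =
  (if ord0 \in A then [:: ord0] else [::]) ++ map (lift ord0) (enum (pred_set A)).
Proof.
have E k (C : {set 'I_k}) : enum C = seq.filter (mem C) (enum 'I_k).
  by rewrite [enum 'I_k]enumT.
rewrite !E enum_ordSl /= filter_map.
have -> : seq.filter (preim (lift ord0) (mem A)) (enum 'I_m) =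
          seq.filter (mem (pred_set A)) (enum 'I_m).
  by apply: eq_filter => i; rewrite /= inE.
by case: ifP.
Qed.

Lemma inversionsE k (C : {set 'I_k}) : inversions C =
  (\sum_(i < k) \sum_(j < k) [&& i \in C, j \notin C & (j < i)%N])%N.
Proof.
rewrite /inversions -sum1_card pair_bigA /= big_mkcond /=.
by apply: eq_bigr => ij _; rewrite [_ \in _]asboolb; case: ifP.
Qed.

Lemma inversions_ordS A : inversions A =
  ((if ord0 \in A then 0 else #|pred_set A|) + inversions (pred_set A))%N.
Proof.
rewrite !inversionsE big_ord_recl /= big1 ?add0n; last first.
  by move=> j _; rewrite ltn0 !andbF.
under eq_bigr => i _.
  rewrite big_ord_recl /= andbT.
  under eq_bigr => j _ do rewrite /bump /= !add1n ltnS.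
  over.
rewrite big_split /=; congr (_ + _)%N; last first.
  by apply: eq_bigr => i _; apply: eq_bigr => j _; rewrite !inE.
case: ifP => _; first by rewrite big1// => i _; rewrite andbF.
by rewrite -sum1_card [RHS]big_mkcond /=; apply: eq_bigr => i _; rewrite inE andbT; case: ifP.
Qed.

Lemma big_set_ordS (V : nmodType) (H : {set 'I_m.+1} -> V) :
  \sum_(A : {set 'I_m.+1}) H A =
  \sum_(B : {set 'I_m}) H (ord0 |: lift ord0 @: B) + \sum_(B : {set 'I_m}) H (lift ord0 @: B).
Proof.
rewrite (bigID (fun A : {set 'I_m.+1} => ord0 \in A)) /=; congr (_ + _).
  rewrite (reindex_onto (fun B : {set 'I_m} => ord0 |: lift ord0 @: B) (fun A : {set 'I_m.+1} => pred_set A)) /=.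
    apply: eq_bigl => B; rewrite !inE eqxx /=; apply/eqP/setP => i.
    by rewrite !inE /= mem_imset //; exact: lift_inj.
  move=> A A0; apply/setP => i; rewrite !inE; case: (unliftP ord0 i) => [j|] -> //.
    by rewrite mem_imset ?inE //; exact: lift_inj.
rewrite (reindex_onto (fun B : {set 'I_m} => lift ord0 @: B) (fun A : {set 'I_m.+1} => pred_set A)) /=.
  apply: eq_bigl => B; rewrite andbC.
  have -> /= : pred_set (lift ord0 @: B) == B.
    by apply/eqP/setP => i; rewrite !inE /= mem_imset //; exact: lift_inj.
  by apply/imsetP => -[j _].
move=> A A0; apply/setP => i; case: (unliftP ord0 i) => [j|] -> //.
  by rewrite mem_imset ?inE //; exact: lift_inj.
by rewrite (negPf A0); apply/negbTE/imsetP => -[j _].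
Qed.

End SubsetRecursion.

Section ShuffleSum.
Variables (R : realType) (T : Type).

(** Signed sum over all ways to split a sequence in two, computed on the head:
    when the head goes to the second part it jumps over the whole first part,
    whence the sign.  In terms of products, the recursion says that inserting a
    vector is an antiderivation. *)
Fixpoint shuffle_sum (F : seq T -> seq T -> R) (xs : seq T) : R :=
  if xs is x :: xs' then
    shuffle_sum (fun s t => F (x :: s) t) xs'
    + shuffle_sum (fun s t => (-1) ^+ size s * F s (x :: t)) xs'
  else F [::] [::].

Lemma subfamily_cons x (xs : seq T) (A : {set 'I_(size (x :: xs))}) :
  subfamily A = (if ord0 \in A then [:: x] else [::])
                ++ subfamily (lift ord0 @^-1: A : {set 'I_(size xs)}).
Proof.
rewrite /subfamily /image_mem (@enum_ordS_set (size xs) A) map_cat -map_comp.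
congr (_ ++ _); first by case: ifP.
by apply: eq_map => i /=; rewrite /tnth; apply: set_nth_default; exact: (ltn_ord i).
Qed.

Lemma size_subfamily (xs : seq T) (A : {set 'I_(size xs)}) :
  size (subfamily A) = #|A|.
Proof. by rewrite size_map -cardE. Qed.

(** This trades sums over subsets, indexed by dependent types, for a structural
    recursion on the sequence, on which all later inductions run. *)
Lemma shuffle_sumE (F : seq T -> seq T -> R) (xs : seq T) :
  \sum_(A : {set 'I_(size xs)})
    (-1) ^+ inversions A * F (subfamily A) (subfamily (~: A)) = shuffle_sum F xs.
Proof.
elim: xs F => [|x xs IH] F /=.
  have E0 (A : {set 'I_0}) : A = finset.set0 by apply/setP => -[].
  have s0 (A : {set 'I_(size (@nil T))}) : subfamily A = [::].
    by apply/size0nil; rewrite size_subfamily (E0 A) finset.cards0.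
  rewrite (bigD1 finset.set0)//= big1 ?addr0 => [|A]; last by rewrite (E0 A) eqxx.
  by rewrite !s0 inversionsE big_ord0 mul1r.
rewrite (big_set_ordS (m := size xs)) -!IH; congr (_ + _); apply: eq_bigr => B _.
  set A := ord0 |: _.
  have BA : B = lift ord0 @^-1: A.
    by apply/setP => i; rewrite !inE /= mem_imset //; exact: lift_inj.
  have A0 : ord0 \in A by rewrite !inE eqxx.
  rewrite inversions_ordS !subfamily_cons A0 finset.in_setC A0 /= add0n BA.
  by rewrite -finset.preimsetC.
set A := lift ord0 @: _.
have BA : B = lift ord0 @^-1: A.
  by apply/setP => i; rewrite !inE /= mem_imset //; exact: lift_inj.
have A0 : (ord0 \in A) = false by apply/imsetP => -[j _].
rewrite inversions_ordS !subfamily_cons A0 finset.in_setC A0 /= BA -finset.preimsetC size_subfamily exprD.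
by rewrite [_ * (-1) ^+ inversions _]mulrC !mulrA.
Qed.

End ShuffleSum.

Section ShuffleTheory.
Variables (R : realType) (T : Type).
Implicit Types (F : seq T -> seq T -> R) (f : seq T -> R) (xs : seq T).

Lemma eq_shuffle_sum F F' xs : F =2 F' -> shuffle_sum F xs = shuffle_sum F' xs.
Proof. by move=> FF'; congr shuffle_sum; apply/funext => s; apply/funext => t. Qed.

Lemma shuffle_sum_lin (J : Type) (r : seq J) (a : J -> R) (F : J -> seq T -> seq T -> R) xs :
  shuffle_sum (fun s t => \sum_(j <- r) a j * F j s t) xs =
  \sum_(j <- r) a j * shuffle_sum (F j) xs.
Proof.
elim: xs F => [|x xs IH] F //=.
rewrite IH; under [X in _ + X]eq_shuffle_sum => s t.
  rewrite mulr_sumr; under eq_bigr do rewrite mulrCA; over.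
by rewrite IH -big_split /=; apply: eq_bigr => j _; rewrite mulrDr.
Qed.

Lemma shuffle_sum0 xs : shuffle_sum (fun _ _ => 0 : R) xs = 0.
Proof.
elim: xs => //= x xs IH; rewrite IH add0r -[RHS]IH.
by apply: eq_shuffle_sum => s t; rewrite mulr0.
Qed.

Lemma shuffle_sum_nilr f xs :
  shuffle_sum (fun s t => f s * (nilp t)%:R) xs = f xs.
Proof.
elim: xs f => [|x xs IH] f /=; first by rewrite mulr1.
rewrite IH -[RHS]addr0 -(shuffle_sum0 xs); congr (_ + _).
by apply: eq_shuffle_sum => s t; rewrite !mulr0.
Qed.

Lemma shuffle_sum_deg0 (c : R) f xs :
  shuffle_sum (fun s t => (if s is [::] then c else 0) * f t) xs = c * f xs.
Proof.
elim: xs f => //= x xs IH f; rewrite -[RHS](IH (fun s => f (x :: s))) -[RHS]add0r.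
congr (_ + _).
  by rewrite -[RHS](shuffle_sum0 xs); apply: eq_shuffle_sum => s t; rewrite mul0r.
apply: eq_shuffle_sum => s t.
by case: s => [|y s]; rewrite ?mul1r // !mul0r mulr0.
Qed.

Lemma dmulE (omega theta : dform R T) xs ys : dmul omega theta xs ys =
  shuffle_sum (fun s s' => shuffle_sum (fun t t' => omega s t * theta s' t') ys) xs.
Proof.
rewrite -shuffle_sumE; apply: eq_bigr => A _; rewrite -shuffle_sumE mulr_sumr.
by apply: eq_bigr => B _; rewrite !mulrA.
Qed.

Lemma dmulr1 (omega : dform R T) : dmul omega (@dform_one R T) = omega.
Proof.
apply/funext => xs; apply/funext => ys; rewrite dmulE.
under eq_shuffle_sum => s s'.
  under eq_shuffle_sum => t t' do rewrite /dform_one -mulnb natrM mulrA.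
  rewrite (shuffle_sum_nilr (fun t => omega s t * (nilp s')%:R)); over.
by rewrite (shuffle_sum_nilr (fun s => omega s ys)).
Qed.

End ShuffleTheory.

Section Pullback.
Variables (R : realType) (V : Type) (n : nat) (e : 'I_n -> V).
Implicit Types omega theta : dform R V.

(** The components of a double form in the family [e], as a double form on the
    set of indices. *)
Definition pullback omega : dform R 'I_n := fun xs ys => omega (map e xs) (map e ys).

Lemma shuffle_sum_map (F : seq V -> seq V -> R) (xs : seq 'I_n) :
  shuffle_sum F (map e xs) = shuffle_sum (fun s t => F (map e s) (map e t)) xs.
Proof.
elim: xs F => //= x xs IH F; rewrite !IH; congr (_ + _).
by apply: eq_shuffle_sum => s t; rewrite size_map.
Qed.

Lemma pullback_dmul omega theta :
  pullback (dmul omega theta) = dmul (pullback omega) (pullback theta).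
Proof.
apply/funext => xs; apply/funext => ys; rewrite /pullback !dmulE shuffle_sum_map.
by apply: eq_shuffle_sum => s s'; rewrite shuffle_sum_map.
Qed.

Lemma pullback_dpow omega k : pullback (dpow omega k) = dpow (pullback omega) k.
Proof.
elim: k => [|k IH]; last by rewrite /dpow !iterS -!/(dpow _ _) pullback_dmul IH.
by apply/funext => xs; apply/funext => ys; rewrite /pullback /dpow /= /dform_one /nilp !size_map.
Qed.

Lemma pullback_dcontract omega m :
  pullback (iter m (dcontract e) omega) = iter m (dcontract id) (pullback omega).
Proof. by elim: m => //= m <-. Qed.

Lemma dinner_pullback omega theta :
  dinner e omega theta = dinner id (pullback omega) (pullback theta).
Proof.
by apply: eq_bigr => A _; apply: eq_bigr => B _; rewrite /pullback -!map_comp.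
Qed.

Lemma gauss_bonnet_pullback omega k :
  gauss_bonnet e omega k = gauss_bonnet id (pullback omega) k.
Proof. by rewrite /gauss_bonnet -pullback_dpow -pullback_dcontract. Qed.

End Pullback.

(** * Exterior multiplication, insertion and contraction *)

Section ExteriorOperators.
Variables (R : realType) (n : nat).
Local Notation I := 'I_n.
Implicit Types (f : seq I -> R) (omega : dform R I) (xs ys : seq I).

(** Exterior multiplication by the [i]-th covector, defined by the
    anticommutation of this operator with insertions. *)
Fixpoint ext (i : I) f xs : R :=
  if xs is x :: xs' then (i == x)%:R * f xs' - ext i (fun s => f (x :: s)) xs' else 0.

Lemma ext_lin (J : Type) (r : seq J) (a : J -> R) (F : J -> seq I -> R) i xs :
  ext i (fun s => \sum_(j <- r) a j * F j s) xs = \sum_(j <- r) a j * ext i (F j) xs.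
Proof.
elim: xs F => [|x xs IH] F /=; first by rewrite big1// => j _; rewrite mulr0.
rewrite IH mulr_sumr -sumrB; apply: eq_bigr => j _; ring.
Qed.

Lemma ext_opp f i xs : ext i (fun s => - f s) xs = - ext i f xs.
Proof. by elim: xs f => [|x xs IH] f /=; rewrite ?oppr0// IH; ring. Qed.

(** Only neighbours are exchanged, but anywhere in the sequence: in this form the
    property passes to the function obtained by fixing the head. *)
Definition alt_seq f :=
  forall s x y t, f (s ++ x :: y :: t) = - f (s ++ y :: x :: t).

Lemma alt_seq_cons f x : alt_seq f -> alt_seq (fun s => f (x :: s)).
Proof. by move=> altf s; exact: (altf (x :: s)). Qed.

Lemma alt_seq_ext i f : alt_seq f -> alt_seq (ext i f).
Proof.
move=> + s; elim: s f => [|z s IH] f altf x y t /=.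
  have -> : (fun s => f [:: x, y & s]) = (fun s => - f [:: y, x & s]).
    by apply/funext => s; exact: (altf [::]).
  by rewrite ext_opp; ring.
by rewrite altf (IH _ (alt_seq_cons z altf)); ring.
Qed.

Definition altl omega := forall ys, alt_seq (fun xs => omega xs ys).
Definition altr omega := forall xs, alt_seq (omega xs).

(** The suffix [l] or [r] tells on which of the two groups of arguments an
    operator acts; [iotal] and [iotar] insert a frame vector. *)
Definition extl i omega : dform R I := fun xs ys => ext i (fun s => omega s ys) xs.
Definition extr i omega : dform R I := fun xs ys => ext i (omega xs) ys.
Definition iotal i omega : dform R I := fun xs ys => omega (i :: xs) ys.
Definition iotar i omega : dform R I := fun xs ys => omega xs (i :: ys).
Definition transpose omega : dform R I := fun xs ys => omega ys xs.

Lemma altr_extl i omega : altr omega -> altr (extl i omega).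
Proof.
move=> alt xs s x y t; rewrite /extl.
have -> : (fun xs => omega xs (s ++ [:: x, y & t])) =
          (fun xs => - omega xs (s ++ [:: y, x & t])).
  by apply/funext => zs; exact: alt.
by rewrite ext_opp.
Qed.

Lemma altl_extl i omega : altl omega -> altl (extl i omega).
Proof. by move=> alt ys; exact: alt_seq_ext. Qed.

Lemma altr_extr i omega : altr omega -> altr (extr i omega).
Proof. exact: (@altl_extl i (transpose omega)). Qed.

Lemma altl_extr i omega : altl omega -> altl (extr i omega).
Proof. exact: (@altr_extl i (transpose omega)). Qed.

Lemma altl_iotal i omega : altl omega -> altl (iotal i omega).
Proof. by move=> alt ys; exact: (alt_seq_cons i (alt ys)). Qed.

Lemma altr_iotar i omega : altr omega -> altr (iotar i omega).
Proof. by move=> alt xs; exact: (alt_seq_cons i (alt xs)). Qed.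

Lemma altr_iotal i omega : altr omega -> altr (iotal i omega).
Proof. by move=> alt xs; exact: alt. Qed.

Lemma altl_iotar i omega : altl omega -> altl (iotar i omega).
Proof. by move=> alt xs; exact: alt. Qed.

Local Notation c := (dcontract (id : I -> I)).

Lemma altl_contract omega : altl omega -> altl (c omega).
Proof.
move=> alt ys s x y t; rewrite /dcontract -sumrN; apply: eq_bigr => i _.
exact: (alt _ (i :: s)).
Qed.

Lemma altr_contract omega : altr omega -> altr (c omega).
Proof.
move=> alt xs s x y t; rewrite /dcontract -sumrN; apply: eq_bigr => i _.
exact: (alt _ (i :: s)).
Qed.

(** The value of the [m]-th iterated contraction on empty sequences, that is, the
    full contraction when [omega] has bidegree [(m, m)]. *)
Definition trace m omega : R := iter m c omega [::] [::].

Lemma traceS m omega : trace m.+1 omega = trace m (c omega).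
Proof. by rewrite /trace iterSr. Qed.

Lemma trace_lin (J : Type) (r : seq J) (a : J -> R) (F : J -> dform R I) m :
  trace m (fun xs ys => \sum_(j <- r) a j * F j xs ys) = \sum_(j <- r) a j * trace m (F j).
Proof.
elim: m F => [//|m IH] F; rewrite traceS.
under [RHS]eq_bigr do rewrite traceS; rewrite -IH; congr trace.
apply/funext => xs; apply/funext => ys; rewrite /dcontract exchange_big /=.
by apply: eq_bigr => j _; rewrite mulr_sumr.
Qed.

Lemma traceZ a omega m : trace m (fun xs ys => a * omega xs ys) = a * trace m omega.
Proof.
have := trace_lin [:: tt] (fun=> a) (fun=> omega) m; rewrite big_seq1 => <-.
by congr trace; apply/funext => xs; apply/funext => ys; rewrite big_seq1.
Qed.

Lemma traceB omega theta m :
  trace m (fun xs ys => omega xs ys - theta xs ys) = trace m omega - trace m theta.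
Proof.
have := trace_lin [:: true; false] (fun b : bool => (-1) ^+ (~~ b))
  (fun b : bool => if b then omega else theta) m.
rewrite !big_cons !big_nil /= mul1r mulN1r addr0 => <-; congr trace.
by apply/funext => xs; apply/funext => ys; rewrite !big_cons big_nil /= mul1r mulN1r addr0.
Qed.

Lemma trace_transpose omega m : trace m (transpose omega) = trace m omega.
Proof. by elim: m omega => [//|m IH] omega; rewrite !traceS -[RHS]IH. Qed.

(** Only the insertion in the first group meets [ext i]; it gives a Kronecker
    delta, which selects one insertion in the second group, minus the term where
    the operators are exchanged. *)
Lemma contract_extl i omega :
  c (extl i omega) = (fun xs ys => iotar i omega xs ys - extl i (c omega) xs ys).
Proof.
apply/funext => xs; apply/funext => ys; rewrite /dcontract /extl /= sumrB.
congr (_ - _).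
  rewrite (bigD1 i)//= eqxx mul1r big1 ?addr0// => j /negPf ji.
  by rewrite eq_sym ji mul0r.
have := ext_lin (index_enum I) (fun=> 1) (fun j s => omega (j :: s) (j :: ys)) i xs.
under eq_bigr do rewrite mul1r; move=> <-; congr ext.
by apply/funext => s; apply: eq_bigr => j _; rewrite mul1r.
Qed.

Lemma contract_iotar i omega : altr omega ->
  c (iotar i omega) = (fun xs ys => - iotar i (c omega) xs ys).
Proof.
move=> alt; apply/funext => xs; apply/funext => ys; rewrite /dcontract /iotar -sumrN.
by apply: eq_bigr => j _; exact: (alt _ [::]).
Qed.

(** Induction by [contract_extl]: the term where [extl i] stays outside vanishes
    at the end, because [ext i] vanishes on the empty sequence, and each of the
    [m] contractions contributes once, the signs compensating as insertions
    anticommute. *)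
Lemma trace_extl i omega m : altr omega ->
  trace m (extl i omega) = m%:R * trace m.-1 (iotar i omega).
Proof.
elim: m omega => [|m IH] omega alt; first by rewrite mul0r.
rewrite traceS contract_extl traceB IH; last exact: altr_contract.
case: m {IH} => [|m] /=; first by rewrite mul0r subr0 mul1r.
rewrite traceS contract_iotar// [in RHS]/=.
have := traceZ (-1) (iotar i (c omega)) m; under eq_fun do under eq_fun do rewrite mulN1r.
move=> ->; rewrite -natr1; ring.
Qed.

Lemma trace_extr i omega m : altl omega ->
  trace m (extr i omega) = m%:R * trace m.-1 (iotal i omega).
Proof.
by move=> alt; rewrite -trace_transpose -[in RHS]trace_transpose; exact: trace_extl.
Qed.

End ExteriorOperators.

(** * The product by a curvature-like form *)

Section ProductExpansion.
Variables (R : realType) (n : nat).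
Local Notation I := 'I_n.
Implicit Types (f : seq I -> R) (omega Om : dform R I) (xs ys : seq I).

Lemma sum_delta (J : finType) (F : J -> R) i : \sum_j (j == i)%:R * F j = F i.
Proof.
rewrite (bigD1 i)//= eqxx mul1r big1 ?addr0// => j /negPf ->.
by rewrite mul0r.
Qed.

Lemma shuffle_sum_deg1 (b : I -> R) f xs :
  shuffle_sum (fun s t => (if s is [:: x] then b x else 0) * f t) xs =
  \sum_i b i * ext i f xs.
Proof.
elim: xs f => [|x xs IH] f /=.
  by rewrite mul0r big1// => i _; rewrite mulr0.
under [RHS]eq_bigr do rewrite mulrBr mulrCA.
rewrite sumrB -IH sum_delta; congr (_ + _).
  rewrite -(shuffle_sum_deg0 (b x) f xs); apply: eq_shuffle_sum => s t.
  by case: s.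
rewrite -[RHS]mulN1r.
have := shuffle_sum_lin [:: tt] (fun=> -1)
  (fun _ s t => (if s is [:: y] then b y else 0) * f (x :: t)) xs.
rewrite big_seq1 => <-; apply: eq_shuffle_sum => -[|y [|z s]] t; rewrite big_seq1 /=; ring.
Qed.

(** A 2-covector is half the sum of its components times products of basis
    covectors. *)
Lemma shuffle_sum_deg2 (a : I -> I -> R) f xs : (forall x y, a x y = - a y x) ->
  shuffle_sum (fun s t => (if s is [:: x; y] then a x y else 0) * f t) xs =
  2%:R^-1 * \sum_i \sum_j a i j * ext i (ext j f) xs.
Proof.
move=> aN; elim: xs f => [|x xs IH] f.
  rewrite /= mul0r big1 ?mulr0// => i _; rewrite big1// => j _; rewrite mulr0 //.
have E i j : ext i (ext j f) (x :: xs) = (i == x)%:R * ext j f xs -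
    ((j == x)%:R * ext i f xs - ext i (ext j (fun s => f (x :: s))) xs).
  rewrite [LHS]/=; congr (_ - _).
  have := ext_lin [:: true; false] (fun b : bool => if b then (j == x)%:R else -1)
   (fun b : bool => if b then f else ext j (fun s => f (x :: s))) i xs.
  rewrite !big_cons !big_nil /= mulN1r addr0 => <-; congr ext.
  by apply/funext => s; rewrite !big_cons !big_nil /= mulN1r addr0.
have E1 : \sum_i \sum_j a i j * ((i == x)%:R * ext j f xs) = \sum_j a x j * ext j f xs.
  by rewrite exchange_big; apply: eq_bigr => j _; under eq_bigr do rewrite mulrCA; rewrite sum_delta.
have E2 : \sum_i \sum_j a i j * ((j == x)%:R * ext i f xs) = - \sum_j a x j * ext j f xs.
  rewrite -sumrN; apply: eq_bigr => i _; under eq_bigr do rewrite mulrCA.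
  by rewrite sum_delta aN mulNr.
have -> : \sum_i \sum_j a i j * ext i (ext j f) (x :: xs) =
    \sum_j a x j * ext j f xs - (- \sum_j a x j * ext j f xs
      - \sum_i \sum_j a i j * ext i (ext j (fun s => f (x :: s))) xs).
  rewrite -[in X in _ - (X - _)]E2 -[X in X - _]E1 -!sumrB; apply: eq_bigr => i _.
  by rewrite -!sumrB; apply: eq_bigr => j _; rewrite E !mulrBr.
(* [A] is the contribution where the head is one of the two slots of [a]. *)
have halve (A B : R) : 2%:R^-1 * (A - (- A - B)) = A + 2%:R^-1 * B by field.
rewrite halve -IH; congr (_ + _); first exact: (shuffle_sum_deg1 (a x)).
apply: eq_shuffle_sum => -[|y [|z [|w s]]] t /=; ring.
Qed.

Variable r : I -> I -> I -> I -> R.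
Hypothesis rN : forall i j k l, r i j k l = - r j i k l.
Hypothesis rC : forall i j k l, r i j k l = r k l i j.

Definition curvature_form : dform R I := fun xs ys =>
  match xs, ys with [:: i; j], [:: k; l] => r i j k l | _, _ => 0 end.

Lemma rNr i j k l : r i j k l = - r i j l k.
Proof. by rewrite rC rN rC. Qed.

Lemma dmul_curvature Om : dmul curvature_form Om = (fun xs ys =>
  \sum_i \sum_j \sum_k \sum_l
    4%:R^-1 * r i j k l * extl i (extl j (extr k (extr l Om))) xs ys).
Proof.
apply/funext => xs; apply/funext => ys; rewrite dmulE.
under eq_shuffle_sum => s s'.
  have -> : shuffle_sum (fun t t' => curvature_form s t * Om s' t') ys =
     \sum_(kl : I * I) 2%:R^-1 * ((if s is [:: i; j] then r i j kl.1 kl.2 else 0)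
       * extr kl.1 (extr kl.2 Om) s' ys).
    rewrite -mulr_sumr.
    rewrite -(pair_bigA _ (fun k l => (if s is [:: i; j] then r i j k l else 0)
       * extr k (extr l Om) s' ys)) /=.
    rewrite -[RHS]shuffle_sum_deg2; last by case: s => [|? [|? [|? ?]]] *; rewrite ?oppr0//; exact: rNr.
    by apply: eq_shuffle_sum => t t'; case: s => [|? [|? [|? ?]]] //; case: t => [|? [|? [|? ?]]].
  over.
rewrite shuffle_sum_lin.
under eq_bigr => kl _.
  rewrite (shuffle_sum_deg2 (a := fun i j => r i j kl.1 kl.2)
    (fun s' => extr kl.1 (extr kl.2 Om) s' ys)); last by [].
  rewrite mulrA mulr_sumr; under eq_bigr do rewrite mulr_sumr.
  over.
rewrite -(pair_bigA _ (fun k l => \sum_i \sum_j 2%:R^-1 / 2%:R * (r i j k l *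
   ext i (ext j (fun s' => extr k (extr l Om) s' ys)) xs))) /= sum_pairC.
do 4![apply: eq_bigr => ? _]; rewrite /extl.
rewrite mulrA; congr (_ * _); congr (_ * _); by field.
Qed.
End ProductExpansion.

(** * The full contraction of the product *)

Section TraceFormula.
Variables (R : realType) (n : nat).
Local Notation I := 'I_n.
Implicit Types (f : seq I -> R) (omega Om X : dform R I) (xs ys : seq I).
Local Notation c := (dcontract (id : I -> I)).

Lemma trace_sum (J : Type) (s : seq J) (F : J -> dform R I) m :
  trace m (fun xs ys => \sum_(j <- s) F j xs ys) = \sum_(j <- s) trace m (F j).
Proof.
have := trace_lin s (fun=> 1) F m; under eq_bigr do rewrite mul1r.
move=> <-; congr trace; apply/funext => xs; apply/funext => ys.
by apply: eq_bigr => j _; rewrite mul1r.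
Qed.

Lemma iotar_extr i k X : iotar i (extr k X) =
  (fun xs ys => (k == i)%:R * X xs ys - extr k (iotar i X) xs ys).
Proof. by []. Qed.

Lemma trace_iotar_extr p j l X : altl X -> trace p (iotar j (extr l X)) =
  (l == j)%:R * trace p X - p%:R * trace p.-1 (iotal l (iotar j X)).
Proof.
move=> alt; rewrite iotar_extr (traceB (fun xs ys => _ * X xs ys)) traceZ.
by rewrite trace_extr//; exact: altl_iotar.
Qed.

Lemma trace_iotar2_extr p i j l X : altl X -> trace p (iotar j (iotar i (extr l X))) =
  (l == i)%:R * trace p (iotar j X) - ((l == j)%:R * trace p (iotar i X)
     - p%:R * trace p.-1 (iotal l (iotar j (iotar i X)))).
Proof.
move=> alt; rewrite -trace_iotar_extr; last exact: altl_iotar.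
by rewrite -traceZ -traceB.
Qed.

(** Both insertions are moved to the right of both exterior multiplications; the
    exterior multiplications that remain in front are traded for insertions in
    the first group by [trace_extr]. *)
Lemma trace_wick p i j k l Om : altl Om ->
  trace p (iotar j (iotar i (extr k (extr l Om)))) =
  (k == i)%:R * ((l == j)%:R * trace p Om - p%:R * trace p.-1 (iotal l (iotar j Om)))
  - (k == j)%:R * ((l == i)%:R * trace p Om - p%:R * trace p.-1 (iotal l (iotar i Om)))
  + p%:R * ((l == i)%:R * trace p.-1 (iotal k (iotar j Om))
           - (l == j)%:R * trace p.-1 (iotal k (iotar i Om))
           + p.-1%:R * trace p.-2 (iotal l (iotal k (iotar j (iotar i Om))))).
Proof.
move=> alt; rewrite trace_iotar2_extr; last exact: altl_extr.
rewrite !trace_iotar_extr//.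
have -> : iotal k (iotar j (iotar i (extr l Om))) = iotar j (iotar i (extr l (iotal k Om))).
  by [].
rewrite trace_iotar2_extr; last exact: altl_iotal.
have E (a b d : R) : a - (b - d) = a - b + d by ring.
by rewrite !E; congr (_ - _ + _ * _); exact: E.
Qed.

(** The exterior multiplications of the first group become insertions in the
    second group, one after the other. *)
Lemma trace_ext4 p i j k l Om : altr Om ->
  trace p.+2 (extl i (extl j (extr k (extr l Om)))) =
  p.+2%:R * p.+1%:R * trace p (iotar j (iotar i (extr k (extr l Om)))).
Proof.
move=> ar; have ar2 : altr (extr k (extr l Om)) by do 2![apply: altr_extr].
rewrite trace_extl /=; last exact: altr_extl.
have -> : iotar i (extl j (extr k (extr l Om))) = extl j (iotar i (extr k (extr l Om))).
  by [].
by rewrite trace_extl ?mulrA//; exact: altr_iotar.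
Qed.

Variable r : I -> I -> I -> I -> R.
Hypothesis rN : forall i j k l, r i j k l = - r j i k l.
Hypothesis rC : forall i j k l, r i j k l = r k l i j.

(** The three terms come from two, one and no Kronecker deltas in
    [trace_wick].  By antisymmetry of [r] the two terms with two deltas agree
    after summation, and so do the four terms with one delta. *)
Lemma trace_dmul_curvature p Om : altl Om -> altr Om ->
  trace p.+2 (dmul (curvature_form r) Om) = p.+2%:R * p.+1%:R *
   (2%:R^-1 * (\sum_i \sum_j r i j i j) * trace p Om
    - p%:R * \sum_i \sum_j \sum_l r i j i l * trace p.-1 (iotal l (iotar j Om))
    + 4%:R^-1 * p%:R * p.-1%:R * \sum_i \sum_j \sum_k \sum_l
        r i j k l * trace p.-2 (iotal l (iotal k (iotar j (iotar i Om))))).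
Proof.
move=> al ar; rewrite dmul_curvature//.
pose K0 := trace p Om; pose K1 a b := trace p.-1 (iotal a (iotar b Om)).
pose K2 k l i j := trace p.-2 (iotal l (iotal k (iotar j (iotar i Om)))).
pose P i j := \sum_l r i j i l * K1 l j.
(* [P i j] sums to the contraction of the Ricci tensor with [K1]; the four
   one-delta terms are [P i j] and [P j i], twice each. *)
transitivity (\sum_i \sum_j p.+2%:R * p.+1%:R * 4%:R^-1 * (2%:R * r i j i j * K0
   - 2%:R * p%:R * P i j - 2%:R * p%:R * P j i
   + p%:R * p.-1%:R * \sum_k \sum_l r i j k l * K2 k l i j)).
  rewrite trace_sum; apply: eq_bigr => i _; rewrite trace_sum; apply: eq_bigr => j _.
  rewrite trace_sum.
  transitivity (\sum_k \sum_l p.+2%:R * p.+1%:R * 4%:R^-1 *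
     ((k == i)%:R * (r i j k l * ((l == j)%:R * K0 - p%:R * K1 l j))
     - (k == j)%:R * (r i j k l * ((l == i)%:R * K0 - p%:R * K1 l i))
     + p%:R * ((l == i)%:R * (r i j k l * K1 k j) - (l == j)%:R * (r i j k l * K1 k i)
     + p.-1%:R * (r i j k l * K2 k l i j)))).
    apply: eq_bigr => k _; rewrite trace_sum; apply: eq_bigr => l _.
    rewrite traceZ trace_ext4// trace_wick// /K0 /K1 /K2.
    move: (trace _ _) (trace _ _) (trace _ _) (trace _ _) (trace _ _) (trace _ _) => *.
    by ring.
  under eq_bigr do rewrite -mulr_sumr; rewrite -mulr_sumr; congr (_ * _).
  under eq_bigr do rewrite big_split sumrB /= -!mulr_sumr.
  rewrite big_split sumrB /= !sum_delta -mulr_sumr.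
  have -> : \sum_k \sum_l ((l == i)%:R * (r i j k l * K1 k j)
       - (l == j)%:R * (r i j k l * K1 k i) + p.-1%:R * (r i j k l * K2 k l i j)) =
     \sum_k r i j k i * K1 k j - \sum_k r i j k j * K1 k i
     + p.-1%:R * \sum_k \sum_l r i j k l * K2 k l i j.
    rewrite mulr_sumr -sumrB -big_split; apply: eq_bigr => k _.
    by rewrite big_split sumrB /= !sum_delta -mulr_sumr.
  have E a b : \sum_l r i j a l * ((l == b)%:R * K0 - p%:R * K1 l b) =
     r i j a b * K0 - p%:R * \sum_l r i j a l * K1 l b.
    under eq_bigr do rewrite mulrBr mulrCA [r _ _ _ _ * (p%:R * _)]mulrCA.
    by rewrite sumrB sum_delta -mulr_sumr.
  rewrite !E.
  have -> : \sum_l r i j j l * K1 l i = - P j i.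
    by rewrite -sumrN; apply: eq_bigr => l _; rewrite rN mulNr.
  have -> : \sum_k r i j k i * K1 k j = - P i j.
    by rewrite -sumrN; apply: eq_bigr => l _; rewrite (rNr rN rC) mulNr.
  have -> : \sum_k r i j k j * K1 k i = P j i.
    by apply: eq_bigr => l _; rewrite rN (rNr rN rC) opprK.
  rewrite (rNr rN rC i j j i) -/(P i j).
  by ring.
under eq_bigr do rewrite -mulr_sumr; rewrite -mulr_sumr -[LHS]mulrA; congr (_ * _).
under eq_bigr do rewrite big_split !sumrB /= -!mulr_sumr -mulr_suml -mulr_sumr.
rewrite big_split !sumrB /= -!mulr_sumr -mulr_suml -mulr_sumr.
rewrite [X in _ - _ * X + _]exchange_big /=.
have combine (S A B p1 p2 : R) : 4%:R^-1 * (2%:R * S * K0 - 2%:R * p1 * A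
    - 2%:R * p1 * A + p1 * p2 * B) =
    2%:R^-1 * S * K0 - p1 * A + 4%:R^-1 * p1 * p2 * B by field.
exact: combine.
Qed.

(** By [dmul_curvature], the product is a combination of exterior
    multiplications, which preserve alternation. *)
Lemma alt_dmul_curvature Om : altl Om -> altr Om ->
  altl (dmul (curvature_form r) Om) /\ altr (dmul (curvature_form r) Om).
Proof.
move=> al ar; rewrite dmul_curvature//; split => zs s x y t.
  have a i j k l := altl_extl i (altl_extl j (altl_extr k (altl_extr l al))).
  do 4![rewrite -sumrN; apply: eq_bigr => ? _].
  by rewrite a mulrN.
have a i j k l := altr_extl i (altr_extl j (altr_extr k (altr_extr l ar))).
do 4![rewrite -sumrN; apply: eq_bigr => ? _].
by rewrite a mulrN.
Qed.

Lemma alt_dpow_curvature k :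
  altl (dpow (curvature_form r) k) /\ altr (dpow (curvature_form r) k).
Proof.
elim: k => [|k [al ar]]; last by rewrite /dpow iterS; exact: alt_dmul_curvature.
split=> zs s x y t; rewrite /dpow /= /dform_one /nilp !size_cat /= !addnS ?andbF;
  by rewrite oppr0.
Qed.

(** A contraction inserts one vector on each side, so the signs that arise when
    these pass the two fixed insertions cancel. *)
Lemma iter_contract_iota q a b Om : altl Om -> altr Om ->
  iter q c (iotal a (iotar b Om)) = iotal a (iotar b (iter q c Om)).
Proof.
elim: q Om => // q IH Om al ar; rewrite !iterSr.
have -> : c (iotal a (iotar b Om)) = iotal a (iotar b (c Om)).
  apply/funext => xs; apply/funext => ys; apply: eq_bigr => i _.
  by rewrite /iotal /iotar (al _ [::]) (ar _ [::]) opprK.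
by apply: IH; [exact: altl_contract | exact: altr_contract].
Qed.

Lemma trace_iota q a b Om : altl Om -> altr Om ->
  trace q (iotal a (iotar b Om)) = iter q c Om [:: a] [:: b].
Proof. by move=> al ar; rewrite /trace iter_contract_iota. Qed.

Lemma trace_iota2 q k l i j Om : altl Om -> altr Om ->
  trace q (iotal l (iotal k (iotar j (iotar i Om)))) = iter q c Om [:: k; l] [:: i; j].
Proof.
move=> al ar.
rewrite -[iotal l _]/(iotal l (iotar j (iotal k (iotar i Om)))) /trace.
by rewrite !iter_contract_iota//; [apply: altl_iotal; exact: altl_iotar | apply: altr_iotal; exact: altr_iotar].
Qed.

End TraceFormula.

(** * Inner products and Gauss-Bonnet curvatures *)

Section InnerProduct.
Variables (R : realType) (n : nat).
Local Notation I := 'I_n.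
Implicit Types (F : seq I -> R) (omega theta : dform R I).

Lemma sum_enum1 F : (forall s, size s != 1%N -> F s = 0) ->
  \sum_(A : {set I}) F (enum A) = \sum_i F [:: i].
Proof.
move=> F0; transitivity (\sum_(A : {set I}) \sum_(i | (finset.set1 i) == A) F [:: i]).
  apply: eq_bigr => A _; case: (boolP (#|A| == 1%N)) => [/cards1P[a ->]|A1].
    rewrite enum_set1 (big_pred1 a)// => i; apply/eqP/eqP => [/set1_inj|->] //.
  rewrite F0 -?cardE// big1// => i /eqP iA; move: A1.
  by rewrite -iA cards1.
rewrite (exchange_big_dep xpredT)//=; apply: eq_bigr => i _.
by rewrite (big_pred1 (finset.set1 i))// => A; rewrite eq_sym.
Qed.

Lemma sum_enum0 F : (forall s, size s != 0%N -> F s = 0) ->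
  \sum_(A : {set I}) F (enum A) = F [::].
Proof.
move=> F0; rewrite (bigD1 finset.set0)//= enum_set0 big1 ?addr0// => A A0.
by rewrite F0// -cardE cards_eq0.
Qed.

(** A subset of two elements is enumerated by two ordered pairs. *)
Lemma sum_enum2 F : (forall s, size s != 2%N -> F s = 0) ->
  (forall i j, F [:: i; j] = F [:: j; i]) -> (forall i, F [:: i; i] = 0) ->
  \sum_(A : {set I}) F (enum A) = 2%:R^-1 * \sum_i \sum_j F [:: i; j].
Proof.
move=> F0 FC Fii.
transitivity (2%:R^-1 * \sum_(A : {set I}) \sum_(p : I * I | (p.1 != p.2) && ([set p.1; p.2]%SET == A)) F [:: p.1; p.2]).
  rewrite mulr_sumr; apply: eq_bigr => A _.
  case: (boolP (#|A| == 2%N)) => [A2|A1].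
    have : size (enum A) = 2%N by rewrite -cardE; exact/eqP.
    case E : (enum A) => [|a [|b [|? ?]]]// _.
    have ab : a != b by have := enum_uniq (mem A); rewrite E /= inE andbT.
    have AE : A = [set a; b]%SET.
      by apply/setP => i; rewrite -mem_enum E !inE.
    rewrite (bigD1 (a, b)) /= ?ab ?AE ?eqxx//.
    rewrite (big_pred1 (b, a)) /= => [|[x y]] /=; first by rewrite (FC b); field.
    rewrite !xpair_eqE; apply/idP/idP => [/andP[/andP[xy /eqP/setP S] ne]|/andP[/eqP-> /eqP->]].
      have := S x; have := S y; rewrite !inE !eqxx orbT /=.
      case/esym/orP => /eqP yE; case/esym/orP => /eqP xE; subst x y; move: xy ne;
        by rewrite ?eqxx.
    by rewrite eq_sym ab finset.setUC eqxx (negPf ab) /= ?andbF.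
  rewrite F0 -?cardE// big1 ?mulr0// => -[x y] /andP[/= xy /eqP xyA]; move: A1.
  by rewrite -xyA cards2 xy.
congr (_ * _); rewrite (exchange_big_dep xpredT)//= pair_bigA /=; apply: eq_bigr => -[x y] _ /=.
case: (eqVneq x y) => [->|xy].
  by rewrite Fii big_pred0.
by rewrite (big_pred1 [set x; y]%SET)// => A; rewrite eq_sym.
Qed.
End InnerProduct.

Section CurvatureInnerProduct.
Variables (R : realType) (n : nat).
Local Notation I := 'I_n.
Implicit Types (omega theta W : dform R I).
Local Notation c := (dcontract (id : I -> I)).

Lemma dinner_idE omega theta : dinner id omega theta =
  \sum_(A : {set I}) \sum_(B : {set I})
    omega (enum A) (enum B) * theta (enum A) (enum B).
Proof. by apply: eq_bigr => A _; apply: eq_bigr => B _; rewrite /image_mem !map_id. Qed.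

Lemma dinnerZ a omega theta :
  dinner id (form_scale a omega) theta = a * dinner id omega theta.
Proof.
rewrite /dinner mulr_sumr; apply: eq_bigr => A _; rewrite mulr_sumr.
by apply: eq_bigr => B _; rewrite mulrA.
Qed.

Lemma dinner_deg0 omega theta :
  (forall xs ys, size xs != 0%N -> theta xs ys = 0) ->
  (forall xs ys, size ys != 0%N -> theta xs ys = 0) ->
  dinner id omega theta = omega [::] [::] * theta [::] [::].
Proof.
move=> tl tr; rewrite dinner_idE.
rewrite (sum_enum0 (F := fun xs => \sum_(B : {set I}) omega xs (enum B) * theta xs (enum B))).
  by rewrite (sum_enum0 (F := fun ys => omega [::] ys * theta [::] ys))// => s s0; rewrite tr ?mulr0.
by move=> s s0; rewrite big1// => B _; rewrite tl ?mulr0.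
Qed.

Lemma dinner_deg1 omega theta :
  (forall xs ys, size xs != 1%N -> theta xs ys = 0) ->
  (forall xs ys, size ys != 1%N -> theta xs ys = 0) ->
  dinner id omega theta = \sum_a \sum_b omega [:: a] [:: b] * theta [:: a] [:: b].
Proof.
move=> tl tr; rewrite dinner_idE.
rewrite (sum_enum1 (F := fun xs => \sum_(B : {set I}) omega xs (enum B) * theta xs (enum B))).
  apply: eq_bigr => a _.
  by rewrite (sum_enum1 (F := fun ys => omega [:: a] ys * theta [:: a] ys))// => s s0; rewrite tr ?mulr0.
by move=> s s0; rewrite big1// => B _; rewrite tl ?mulr0.
Qed.

Lemma alt_seq2 (f : seq I -> R) (i j : I) : alt_seq f -> f [:: i; j] = - f [:: j; i].
Proof. by move=> alt; exact: (alt [::]). Qed.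

Lemma alt_seq2_diag (f : seq I -> R) (i : I) : alt_seq f -> f [:: i; i] = 0.
Proof. by move=> alt; have := alt_seq2 i i alt; lra. Qed.

Lemma dinner_deg2 omega theta :
  altl omega -> altr omega -> altl theta -> altr theta ->
  (forall xs ys, size xs != 2%N -> theta xs ys = 0) ->
  (forall xs ys, size ys != 2%N -> theta xs ys = 0) ->
  dinner id omega theta = 4%:R^-1 * \sum_i \sum_j \sum_k \sum_l
    omega [:: i; j] [:: k; l] * theta [:: i; j] [:: k; l].
Proof.
move=> ol or tl tr tl0 tr0; rewrite dinner_idE.
have inner xs : \sum_(B : {set I}) omega xs (enum B) * theta xs (enum B) =
    2%:R^-1 * \sum_k \sum_l omega xs [:: k; l] * theta xs [:: k; l].
  apply: (sum_enum2 (F := fun ys => omega xs ys * theta xs ys)).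
  - by move=> s s2; rewrite tr0 ?mulr0.
  - by move=> i j; rewrite (alt_seq2 i j (or xs)) (alt_seq2 i j (tr xs)) mulrNN.
  - by move=> i; rewrite (alt_seq2_diag i (or xs)) mul0r.
under eq_bigr do rewrite inner.
rewrite (sum_enum2 (F := fun xs => 2%:R^-1 * \sum_k \sum_l omega xs [:: k; l] * theta xs [:: k; l])).
- under eq_bigr do rewrite -mulr_sumr.
  by rewrite -mulr_sumr mulrA; congr (_ * _); field.
- move=> s s2; rewrite big1 ?mulr0// => k _; rewrite big1// => l _.
  by rewrite tl0 ?mulr0.
- move=> i j; congr (_ * _); apply: eq_bigr => k _; apply: eq_bigr => l _.
  by rewrite (alt_seq2 i j (ol _)) (alt_seq2 i j (tl _)) mulrNN.
- move=> i; rewrite big1 ?mulr0// => k _; rewrite big1// => l _.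
  by rewrite (alt_seq2_diag i (ol _)) mul0r.
Qed.

Variable r : I -> I -> I -> I -> R.
Hypothesis rN : forall i j k l, r i j k l = - r j i k l.
Hypothesis rC : forall i j k l, r i j k l = r k l i j.
Local Notation Rm := (curvature_form r).

Lemma curvature_form_sizel xs ys : size xs != 2%N -> Rm xs ys = 0.
Proof. by case: xs => [|? [|? [|? ?]]]. Qed.

Lemma curvature_form_sizer xs ys : size ys != 2%N -> Rm xs ys = 0.
Proof. by case: xs => [|? [|? [|? ?]]]//; case: ys => [|? [|? [|? ?]]]. Qed.

Lemma contract_curvature_sizel xs ys : size xs != 1%N -> c Rm xs ys = 0.
Proof. by move=> s; rewrite /dcontract big1// => i _; rewrite curvature_form_sizel. Qed.

Lemma contract_curvature_sizer xs ys : size ys != 1%N -> c Rm xs ys = 0.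
Proof. by move=> s; rewrite /dcontract big1// => i _; rewrite curvature_form_sizer. Qed.

Lemma dpow1 (T : Type) (omega : dform R T) : dpow omega 1 = omega.
Proof. exact: dmulr1. Qed.

Lemma gauss_bonnetE k : gauss_bonnet id Rm k = trace (2 * k) (dpow Rm k) / (2 * k)`!%:R.
Proof. by []. Qed.

Lemma gauss_bonnet1 : gauss_bonnet id Rm 1 = 2%:R^-1 * \sum_i \sum_j r i j i j.
Proof.
rewrite gauss_bonnetE dpow1 mulrC; congr (_ * _).
by rewrite /trace /= /dcontract exchange_big.
Qed.

(** [trace_dmul_curvature] for the powers of the curvature.  The symmetry [rC]
    puts the indices of the Ricci tensor and of the curvature in the order in
    which the contracted powers take them. *)
Lemma gauss_bonnet_recursion k : (0 < k)%N ->
  gauss_bonnet id Rm k.+1 =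
     dinner id (form_scale ((2 * k - 2)`!%:R)^-1 (iter (2 * k - 2) c (dpow Rm k))) Rm
   - dinner id (form_scale ((2 * k - 1)`!%:R)^-1 (iter (2 * k - 1) c (dpow Rm k))) (c Rm)
   + gauss_bonnet id Rm k * gauss_bonnet id Rm 1.
Proof.
move=> k0; have [al ar] := alt_dpow_curvature rN rC k.
have altc q : altl (iter q c (dpow Rm k)) /\ altr (iter q c (dpow Rm k)).
  by elim: q => //= q [? ?]; split; [exact: altl_contract | exact: altr_contract].
have [Rl Rr] : altl Rm /\ altr Rm by rewrite -(dpow1 Rm); exact: alt_dpow_curvature.
rewrite !dinnerZ dinner_deg2 //; last exact: curvature_form_sizer; last exact: curvature_form_sizel;
  last exact: (altc _).2; last exact: (altc _).1.
rewrite dinner_deg1; last exact: contract_curvature_sizer; last exact: contract_curvature_sizel.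
rewrite gauss_bonnet1 !gauss_bonnetE.
have -> : (2 * k.+1)%N = (2 * k).+2 by rewrite mulnS add2n.
rewrite [dpow _ k.+1]iterS -/(dpow _ _) trace_dmul_curvature//.
have [q Eq] : exists q, (2 * k)%N = q.+2.
  by exists (2 * k.-1)%N; move: k0; case: (k) => // k1 _; rewrite mulnS add2n.
rewrite Eq subn2 subn1 /=.
pose W2 i j k' l := iter q c (dpow Rm k) [:: i; j] [:: k'; l].
pose W1 a b := iter q.+1 c (dpow Rm k) [:: a] [:: b].
have -> : \sum_i \sum_j \sum_l r i j i l * trace q.+1 (iotal l (iotar j (dpow Rm k))) =
    \sum_a \sum_b W1 a b * c Rm [:: a] [:: b].
  under eq_bigr do rewrite exchange_big.
  rewrite exchange_big; apply: eq_bigr => l _; rewrite exchange_big; apply: eq_bigr => j _.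
  rewrite mulr_sumr; apply: eq_bigr => i _.
  by rewrite trace_iota// mulrC rC.
have -> : \sum_i \sum_j \sum_k' \sum_l r i j k' l *
      trace q (iotal l (iotal k' (iotar j (iotar i (dpow Rm k))))) =
    \sum_i \sum_j \sum_k' \sum_l W2 i j k' l * Rm [:: i; j] [:: k'; l].
  rewrite sum_pairC; do 4![apply: eq_bigr => ? _].
  by rewrite trace_iota2// mulrC rC.
rewrite !factS !natrM.
have nz m : m.+1%:R != 0 :> R by rewrite pnatr_eq0.
have f0 : q`!%:R != 0 :> R by rewrite pnatr_eq0 -lt0n fact_gt0.
move: (nz q.+3) (nz q.+2) (nz q.+1) (nz q) f0.
rewrite -/(W1 _ _).
move: (q.+4%:R) (q.+3%:R) (q.+2%:R) (q.+1%:R) (q`!%:R : R).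
move: (\sum_i _) (\sum_i _) (\sum_i _) (trace _ _) => S A B K.
by move=> a4 a3 a2 a1 a0 n4 n3 n2 n1 n0; field; rewrite n4 n3 n2 n1 n0.
Qed.

Lemma gauss_bonnet2 : gauss_bonnet id Rm 2 =
  dnorm id Rm ^+ 2 - dnorm id (c Rm) ^+ 2 + 4%:R^-1 * dnorm id (c (c Rm)) ^+ 2.
Proof.
have dnorm2 omega : dnorm id omega ^+ 2 = dinner id omega omega.
  by rewrite /dnorm sqr_sqrtr//; do 2![apply: sumr_ge0 => ? _]; exact: sqr_ge0.
rewrite gauss_bonnet_recursion// !dnorm2 !dinnerZ dpow1 /= !invr1 !mul1r.
congr (_ - _ + _); rewrite gauss_bonnetE dpow1.
rewrite dinner_deg0.
- rewrite -[c (c Rm) [::] [::]]/(trace 2 Rm) (_ : (2 * 1)`!%N = 2%N)//.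
  by move: (trace _ _) => x; field.
- by move=> xs ys s; rewrite /dcontract big1// => i _; exact: contract_curvature_sizel.
- by move=> xs ys s; rewrite /dcontract big1// => i _; exact: contract_curvature_sizer.
Qed.

End CurvatureInnerProduct.

Theorem theoremA4 (R : realType) (n : nat) (M : smooth_manifold R n)
    (g : riemannian_metric M) (p : M) (c : chart M) (hp : chart_dom c p)
    (e : 'I_n -> 'rV[R]_n)
    (he : orthonormal_frame (gram g c (chart_map c p)) e) :
  let Rm := riemann g c p in
  let h := gauss_bonnet e Rm in
  (forall k : nat, (4 <= 2 * k + 2 <= n)%N ->
     h k.+1 =
       dinner e (form_scale ((2 * k - 2)`!%:R)^-1
                   (iter (2 * k - 2) (dcontract e) (dpow Rm k))) Rm
     - dinner e (form_scale ((2 * k - 1)`!%:R)^-1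
                   (iter (2 * k - 1) (dcontract e) (dpow Rm k)))
                (dcontract e Rm)
     + h k * h 1%N) /\
  ((4 <= n)%N ->
     h 2%N = dnorm e Rm ^+ 2 - dnorm e (dcontract e Rm) ^+ 2
             + 4%:R^-1 * dnorm e (dcontract e (dcontract e Rm)) ^+ 2).
Proof.
move=> Rm h.
pose r i j k l := Rm [:: e i; e j] [:: e k; e l].
have rN i j k l : r i j k l = - r j i k l by exact: riemann_antisym.
have rC i j k l : r i j k l = r k l i j by exact: riemann_pairC.
have RmE : pullback e Rm = curvature_form r.
  apply/funext => xs; apply/funext => ys.
  by case: xs => [|? [|? [|? ?]]]//; case: ys => [|? [|? [|? ?]]].
have pull_c omega : pullback e (dcontract e omega) = dcontract id (pullback e omega) by [].
have hE k : h k = gauss_bonnet id (curvature_form r) k.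
  by rewrite /h gauss_bonnet_pullback RmE.
split=> [k /andP[k2 _]|_].
  have k0 : (0 < k)%N by case: k k2.
  have scaleE a omega : pullback e (form_scale a omega) = form_scale a (pullback e omega).
    by [].
  rewrite !hE gauss_bonnet_recursion// !(dinner_pullback e).
  by rewrite !scaleE !pullback_dcontract pull_c !pullback_dpow RmE.
rewrite hE gauss_bonnet2// /dnorm !(dinner_pullback e).
by rewrite !pull_c RmE.
Qed.
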